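(* Let $(X,T)$ be a minimal system and let $d\ge 1$ be an integer. Then: (1) for every $x\in X$, the system $(\overline{\mathcal F^{[d]}}(x^{[d]}),\mathcal F^{[d]})$ is minimal; (2) for every $x\in X$, $\overline{\mathcal F^{[d]}}(x^{[d]})$ is the unique $\mathcal F^{[d]}$-minimal subset of $\mathbf Q^{[d]}[x]$.
   Context: A system $(X,T)$ is a compact metric space $X$ with a homeomorphism $T:X\to X$; it is minimal if every orbit $\{T^nx:n\in\mathbb Z\}$ is dense. For an integer $d\ge1$ put $X^{[d]}=X^{\{0,1\}^d}$, points $\mathbf x=(x_\epsilon:\epsilon\in\{0,1\}^d)$; $\epsilon$ is identified with the subset $\{i:\epsilon_i=1\}$ of $\{1,\dots,d\}$, so $\emptyset=(0,\dots,0)$. $x^{[d]}$ is the point with all coordinates $x$. For $1\le j\le d$ the face transformation $T_j^{[d]}:X^{[d]}\to X^{[d]}$ is $(T_j^{[d]}\mathbf x)_\epsilon=Tx_\epsilon$ if $\epsilon_j=1$ and $x_\epsilon$ if $\epsilon_j=0$. The face group $\mathcal F^{[d]}$ is the group generated by $T_1^{[d]},\dots,T_d^{[d]}$, and $\overline{\mathcal F^{[d]}}(\mathbf x)$ is the closure of the $\mathcal F^{[d]}$-orbit of $\mathbf x$. $\mathbf Q^{[d]}=\mathbf Q^{[d]}(X)$ is the closure in $X^{[d]}$ of $\{(T^{n_1\epsilon_1+\cdots+n_d\epsilon_d}x)_{\epsilon\in\{0,1\}^d}: x\in X,(n_1,\dots,n_d)\in\mathbb Z^d\}$, and $\mathbf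 Q^{[d]}[x]=\{\mathbf z\in\mathbf Q^{[d]}(X): z_\emptyset=x\}$. An $\mathcal F^{[d]}$-minimal set is a nonempty closed $\mathcal F^{[d]}$-invariant set containing no proper nonempty closed invariant subset. *)

(* Defs.v *)
From HB Require Import structures.
From mathcomp Require Import all_boot all_order all_algebra.
From mathcomp Require Import all_classical all_reals all_analysis.

Set Implicit Arguments.
Unset Strict Implicit.
Unset Printing Implicit Defensive.

Import Order.TTheory GRing.Theory Num.Theory.

Local Open Scope classical_set_scope.
Local Open Scope ring_scope.

Record homeo (X : topologicalType) := Homeo {
  homeo_fun :> X -> X;
  homeo_inv : X -> X;
  homeo_funK : cancel homeo_fun homeo_inv;
  homeo_invK : cancel homeo_inv homeo_fun;
  homeo_continuous : continuous homeo_fun;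
  homeo_inv_continuous : continuous homeo_inv }.

Definition iterz (X : topologicalType) (T : homeo X) (n : int) (x : X) : X :=
  match n with
  | Posz m => iter m T x
  | Negz m => iter m.+1 (homeo_inv T) x
  end.

Definition minimal_homeo (X : topologicalType) (T : homeo X) : Prop :=
  forall x : X, dense [set iterz T n x | n in [set: int]].

Section SelfMaps.
Variable Y : Type.

(* The third clause ranges over all two-sided inverses g of f; there is at most
   one, and for bijective generators the smallest such H is the usual group. *)
Definition map_group (H : set (Y -> Y)) : Prop :=
  [/\ H id,
      forall f g, H f -> H g -> H (f \o g) &
      forall f g, H f -> cancel f g -> cancel g f -> H g].

Definition generated_group (S : set (Y -> Y)) : set (Y -> Y) :=
  smallest map_group S.

Definition map_orbit (G : set (Y -> Y)) (y : Y) : set Y := [set g y | g in G].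

Definition invariant_set (G : set (Y -> Y)) (A : set Y) : Prop :=
  forall g, G g -> g @` A `<=` A.

End SelfMaps.

(* The system (A, G) for A a subset of Y: since the orbits lie in A, their
   density in A is inclusion of A in their closure taken in Y. *)
Definition minimal_system (Y : topologicalType) (G : set (Y -> Y))
    (A : set Y) : Prop :=
  [/\ compact A, invariant_set G A &
      forall y, A y -> A `<=` closure (map_orbit G y)].

Definition minimal_set (Y : topologicalType) (G : set (Y -> Y))
    (A : set Y) : Prop :=
  [/\ A !=set0, closed A, invariant_set G A &
      forall B : set Y, B !=set0 -> closed B -> invariant_set G B ->
        B `<=` A -> B = A].

Notation vertex d := {ffun 'I_d -> bool}.

Definition vertex0 (d : nat) : vertex d := [ffun=> false].

Notation cube d X := {ptws vertex d -> X}.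

Section Cubes.
Variables (X : topologicalType) (T : homeo X) (d : nat).

Definition diag (x : X) : cube d X := fun=> x.

Definition face_map (j : 'I_d) (x : cube d X) : cube d X :=
  fun e => if e j then T (x e) else x e.

Definition face_group : set (cube d X -> cube d X) :=
  generated_group [set face_map j | j in [set: 'I_d]].

Definition face_orbit_closure (x : cube d X) : set (cube d X) :=
  closure (map_orbit face_group x).

Definition cube_point (x : X) (n : 'I_d -> int) : cube d X :=
  fun e => iterz T (\sum_(i < d) n i * (e i : nat)%:Z) x.

Definition dyn_cubes : set (cube d X) :=
  closure [set z | exists x n, z = cube_point x n].

Definition dyn_cubes_at (x : X) : set (cube d X) :=
  [set z | dyn_cubes z /\ z (vertex0 d) = x].

End Cubes.

Arguments diag {X} d x.
Arguments face_group {X} T d.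
Arguments face_orbit_closure {X} T {d} x.
Arguments dyn_cubes {X} T d.
Arguments dyn_cubes_at {X} T d x.

(* Main.v *)
(* Let E be the closure of {(T^(n.eps))_eps : n in Z^d} in the product of copies
   of X^X: a compact right topological semigroup with face orbit closures E z.
   For a minimal idempotent u of the enveloping semigroup of (X, T), the element
   off0 u = (id at 0, u elsewhere) lies in a minimal left ideal of E; choosing u
   with u x = x, it fixes x^[d], whence (1).

   For (2) it suffices to find x^[d] in E z whenever z is a cube over x. Some x0
   (a continuity point of y |-> E y^[d]) satisfies Q[x0] = E x0^[d]. By induction
   on k we reach a point equal to x on the lower face spanned by the first k
   directions; let w be its restriction to the parallel face one step away in the
   next direction, which may be assumed fixed by u. Moving (x, w) diagonally over
   x0 and then its second half back along that direction shows that (x0, w) and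
   (x0, x) both lie in the minimal set E x0^[d], so some phi in E takes one to the
   other, up to replacing x0 by x1 = u x0 off the vertex 0. It takes (x, w) to
   (phi x, x), which is moved to (phi x, x1) along the new direction. As phi fixes
   x1 and the pair (x, x1) is minimal, an element of E acting equally on both
   faces takes this to (x, x1), and thence one gets to (x, x). *)
From HB Require Import structures.
Require Import Defs.
From mathcomp Require Import all_boot all_order all_algebra.
From mathcomp Require Import all_classical all_reals all_analysis.

Set Implicit Arguments.
Unset Strict Implicit.
Unset Printing Implicit Defensive.

Import Order.TTheory GRing.Theory Num.Theory.

Local Open Scope classical_set_scope.
Local Open Scope ring_scope.

(** * Pointwise topology *)

Section Topology.

Lemma image_closure (A B : topologicalType) (f : A -> B) (S : set A) :
  continuous f -> f @` closure S `<=` closure (f @` S).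
Proof.
move=> cf _ [a Sa <-] V /cf fV; have [b [Sb Vb]] := Sa _ fV.
by exists (f b); split => //; exists b.
Qed.

Lemma closure_subset_closed (A : topologicalType) (S C : set A) :
  closed C -> S `<=` C -> closure S `<=` C.
Proof. by move=> cC SC; apply: subset_trans (closureS SC) cC. Qed.

Lemma image_closed (A B : topologicalType) (f : A -> B) (C : set A) :
  compact [set: A] -> hausdorff_space B -> continuous f ->
  closed C -> closed (f @` C).
Proof.
move=> cA hB cf cC; apply: compact_closed => //.
apply: continuous_compact; first exact: continuous_subspaceT.
exact: subclosed_compact cC cA _.
Qed.

(** The sets [f i] form a base of a proper filter; a cluster point of it lies in each of them. *)
Lemma directed_bigcap (I : Type) (W : topologicalType) (D : set I)
    (f : I -> set W) :
  compact [set: W] -> D !=set0 ->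
  (forall i j, D i -> D j -> exists2 k, D k & f k `<=` f i `&` f j) ->
  (forall i, D i -> closed (f i) /\ f i !=set0) ->
  \bigcap_(i in D) f i !=set0.
Proof.
move=> cW D0 dir fD.
have PF : ProperFilter (filter_from D f).
  apply: filter_from_proper; first exact: filter_from_filter.
  by move=> i /fD [].
have [w [_ cw]] := cW _ PF filterT.
exists w => i Di; apply: (fD i Di).1 => V wV.
by apply: cw => //; exists i.
Qed.

Lemma ptws_continuous (A : topologicalType) (I : eqType) (B : topologicalType)
    (g : A -> {ptws I -> B}) :
  (forall i, continuous (fun a => g a i)) -> continuous g.
Proof.
move=> cg a; apply/cvg_sup.
move=> i; move: a; apply/(@continuousP _ (initial_topology (@^~ i))) => U [V oV <-].
by apply: (open_comp (f := fun a => g a i)) => // x _; exact: cg.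
Qed.

Lemma ptws_eval_continuous (I : eqType) (B : topologicalType) (i : I) :
  continuous (fun f : {ptws I -> B} => f i).
Proof. exact: (@proj_continuous I (fun=> B) i). Qed.

Lemma ptws_compact (I : eqType) (B : topologicalType) :
  compact [set: B] -> compact [set: {ptws I -> B}].
Proof.
move=> cB; have := @tychonoff I (fun=> B) (fun=> setT) (fun=> cB).
by congr (compact _); apply/seteqP; split.
Qed.

Lemma ptws_hausdorff (I : eqType) (B : topologicalType) :
  hausdorff_space B -> hausdorff_space {ptws I -> B}.
Proof. by move=> hB; apply: (@hausdorff_product I (fun=> B)). Qed.

End Topology.

(** * Enveloping semigroups *)

Section RightTopologicalSemigroup.
Variables (W : topologicalType) (op : W -> W -> W).
Hypotheses (cptW : compact [set: W]) (hausW : hausdorff_space W).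
Hypotheses (opA : forall a b c, op (op a b) c = op a (op b c)).
Hypothesis op_continuous : forall b, continuous (op^~ b).

Definition subsemigroup (A : set W) := forall a b, A a -> A b -> A (op a b).

Definition left_ideal (S A : set W) := forall s a, S s -> A a -> A (op s a).

(** Zorn's lemma for unions of chains is applied to the open sets removed from [C]; compactness
    keeps what remains nonempty along a chain. *)
Lemma minimal_closed_subset (Q : set W -> Prop) (C : set W) :
  (forall F : set (set W), F !=set0 -> (forall A, F A -> Q A) ->
     Q (\bigcap_(A in F) A)) ->
  C !=set0 -> closed C -> Q C ->
  exists M, [/\ M !=set0, closed M, M `<=` C, Q M &
    forall M', M' !=set0 -> closed M' -> M' `<=` M -> Q M' -> M' = M].
Proof.
move=> Qcap C0 cC QC.
pose good (M : set W) := [/\ M !=set0, closed M & Q M].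
pose P (U : set W) := open U /\ good (C `\` U).
have [|U [[oU [M0 cM QM]] Umax]] := @Zorn_bigcup _ P.
  move=> F FP tF; split; first by apply: bigcup_open => U /FP [].
  have [->|/set0P F0] := eqVneq F set0.
    by rewrite bigcup_set0 setD0.
  have -> : C `\` \bigcup_(U in F) U = \bigcap_(U in F) (C `\` U).
    apply/seteqP; split=> w.
      by move=> [Cw nw] U FU; split => // Uw; apply: nw; exists U.
    move=> h; split; first by have [U /h []] := F0.
    by move=> [U FU Uw]; have [] := h _ FU.
  split; first 1 last.
  - by apply: closed_bigI => U /FP [_ []].
  - have -> : \bigcap_(U in F) (C `\` U) =
              \bigcap_(A in [set C `\` U | U in F]) A.
      apply/seteqP; split=> w; first by move=> h _ [U FU <-]; exact: h.
      by move=> h U FU; apply: h; exists U.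
    apply: Qcap; last by move=> _ [U /FP [_ []] ? ? ? <-].
    by have [U FU] := F0; exists (C `\` U), U.
  apply: directed_bigcap => // [U V FU FV|U /FP [_ []]]; last by split.
  have [UV|VU] := tF _ _ FU FV.
    by exists V => // w [Cw nVw]; split; split => // /UV.
  by exists U => // w [Cw nUw]; split; split => // /VU.
exists (C `\` U); split => // M' M'0 cM' M'M QM'.
have CM' : C `\` ~` M' = M'.
  apply/seteqP; split=> w; first by move=> [_ /contrapT].
  by move=> M'w; split; [case: (M'M _ M'w)|exact].
apply/seteqP; split => // w [Cw nUw]; apply: contrapT => nM'w.
apply: (Umax (~` M')).
  split; first by move=> v Uv /M'M [].
  by move=> sub; apply: nUw; apply: sub.
by split; [exact: closed_openC|rewrite CM'].
Qed.

(** The Ellis-Numakura lemma. For [v] in a minimal closed subsemigroup [M], both [M v] and the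
    solutions [a] of [a v = v] in [M] are closed subsemigroups, hence equal to [M]; so [v] is itself
    a solution. *)
Lemma exists_idempotent (C : set W) :
  C !=set0 -> closed C -> subsemigroup C -> exists2 v, C v & op v v = v.
Proof.
move=> C0 cC sC.
have [|M [[v Mv] cM MC sM Mmin]] := minimal_closed_subset _ C0 cC sC.
  move=> F F0 FQ a b ha hb A FA; apply: (FQ _ FA); [exact: ha|exact: hb].
have eM : op^~ v @` M = M.
  apply: Mmin; first by exists (op v v), v.
  - exact: image_closed.
  - by move=> _ [a Ma <-]; exact: sM.
  move=> _ _ [a Ma <-] [b Mb <-]; exists (op (op a v) b); last by rewrite !opA.
  by apply: (sM) => //; exact: sM.
have fixM : M `&` [set a | op a v = v] = M.
  apply: Mmin.
  - by have : M v by []; rewrite -{1}eM => -[a Ma av]; exists a.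
  - apply: closedI => //.
    have : closed (op^~ v @^-1` [set v]); last by [].
    apply: preimage_closed => //.
    exact/accessible_closed_set1/hausdorff_accessible.
  - by move=> a [].
  - move=> a b [Ma av] [Mb bv]; split; first exact: sM.
    by rewrite /= opA bv av.
by exists v; [exact: MC|have : M v by []; rewrite -{1}fixM => -[]].
Qed.

(** For [a] in a minimal closed left ideal [L], the set [S a] is a closed left ideal inside [L],
    hence all of [L]. *)
Lemma exists_minimal_left_ideal (S : set W) :
  S !=set0 -> closed S -> subsemigroup S ->
  exists L, [/\ L !=set0, closed L, L `<=` S, left_ideal S L &
    forall a b, L a -> L b -> exists2 s, S s & op s a = b].
Proof.
move=> S0 cS sS.
have [|L [L0 cL LS iL Lmin]] := @minimal_closed_subset (left_ideal S) S _ S0 cS sS.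
  by move=> F F0 FQ s a Ss ha A FA; apply: (FQ _ FA) => //; exact: ha.
exists L; split => // a b La.
suff -> : L = op^~ a @` S by move=> [s Ss <-]; exists s.
apply/esym/Lmin.
- by have [s Ss] := S0; exists (op s a), s.
- exact: image_closed.
- by move=> _ [s Ss <-]; exact: iL.
- by move=> t _ St [s Ss <-]; exists (op t s); [exact: sS|rewrite opA].
Qed.

End RightTopologicalSemigroup.

(** * Pointwise limits of families of self-maps *)

Section Enveloping.
Variables (X : topologicalType) (K : eqType).
Hypotheses (cptX : compact [set: X]) (hausX : hausdorff_space X).

(** The index type [K] is the vertex set for the action on cubes, and [unit] for the enveloping
    semigroup of a single homeomorphism. *)
Definition self_maps := {ptws K -> {ptws X -> X}}.

Definition self_comp (e f : self_maps) : self_maps := fun k x => e k (f k x).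

Lemma self_mapsP (e f : self_maps) : (forall k x, e k x = f k x) -> e = f.
Proof. by move=> ef; apply: funext => k; apply: funext => x. Qed.

Lemma self_maps_compact : compact [set: self_maps].
Proof. by do 2!apply: ptws_compact. Qed.

Lemma self_maps_hausdorff : hausdorff_space self_maps.
Proof. by do 2!apply: ptws_hausdorff. Qed.

Lemma self_eval_continuous k x : continuous (fun e : self_maps => e k x).
Proof.
move=> e; apply: (@continuous_comp _ _ _ (fun e : self_maps => e k)
   (fun f : {ptws X -> X} => f x)); exact: ptws_eval_continuous.
Qed.

Lemma self_maps_continuous (A : topologicalType) (g : A -> self_maps) :
  (forall k x, continuous (fun a => g a k x)) -> continuous g.
Proof. by move=> cg; do 2!apply: ptws_continuous => ?. Qed.

Lemma self_compA e f g :
  self_comp (self_comp e f) g = self_comp e (self_comp f g).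
Proof. by []. Qed.

Lemma self_comp_continuous f : continuous (self_comp^~ f).
Proof. by apply: self_maps_continuous => k x; exact: self_eval_continuous. Qed.

(** Right translations are continuous, left translations only by continuous maps: the right factor
    passes to the limit first, with the left one in [S], and then the left factor. *)
Lemma closure_subsemigroup (S : set self_maps) :
  (forall s k, S s -> continuous (s k : X -> X)) ->
  subsemigroup self_comp S -> subsemigroup self_comp (closure S).
Proof.
move=> cS sS.
have left s f : S s -> closure S f -> closure S (self_comp s f).
  move=> Ss Sf; have /image_closure : continuous (self_comp s).
    apply: self_maps_continuous => k x e.
    apply: (@continuous_comp _ _ _ (fun e : self_maps => e k x) (s k)).
      exact: self_eval_continuous.
    exact: cS.
  move=> /(_ S (self_comp s f)) h.
  apply: (@closureS _ (self_comp s @` S)); last by apply: h; exists f.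
  by move=> _ [t St <-]; exact: sS.
move=> e f Se Sf.
have := @image_closure _ _ _ S (self_comp_continuous (f := f)).
move=> /(_ (self_comp e f)) h.
have {}h : closure (self_comp^~ f @` S) (self_comp e f) by apply: h; exists e.
apply: closure_subset_closed h; first exact: closed_closure.
by move=> _ [s Ss <-]; exact: left.
Qed.

End Enveloping.

Arguments self_comp {X K}.

(** * Actions on cubes *)

Section Iterates.
Variables (X : topologicalType) (T : homeo X).

Lemma iterzS (n : int) x : iterz T (n + 1) x = T (iterz T n x).
Proof.
case: n => [n|[|n]]; first by rewrite -PoszD addn1 /= ?iterS.
  by rewrite /= homeo_invK.
have -> : Negz n.+1 + 1 = Negz n by rewrite !NegzE -[n.+2]addn1 PoszD opprD addrNK.
by rewrite /= homeo_invK.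
Qed.

Lemma iterzP (n : int) x : iterz T (n - 1) x = homeo_inv T (iterz T n x).
Proof. by rewrite -{2}(subrK 1 n) iterzS homeo_funK. Qed.

Lemma iterzD (m n : int) x : iterz T (m + n) x = iterz T m (iterz T n x).
Proof.
elim/int_rect: m => [|m IH|m IH]; first by rewrite add0r.
  by rewrite -addn1 PoszD addrAC !iterzS IH.
by rewrite -addn1 PoszD opprD addrAC !iterzP IH.
Qed.

Lemma iterz_continuous (n : int) : continuous (iterz T n).
Proof.
elim/int_rect: n => [x|n IH x|n IH x]; first exact: cvg_id.
  rewrite (_ : iterz T _ = T \o iterz T n); last first.
    by apply: funext => y; rewrite -addn1 PoszD iterzS.
  by apply: continuous_comp; [exact: IH|exact: homeo_continuous].
rewrite (_ : iterz T _ = homeo_inv T \o iterz T (- n%:Z)); last first.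
  by apply: funext => y; rewrite -addn1 PoszD opprD iterzP.
by apply: continuous_comp; [exact: IH|exact: homeo_inv_continuous].
Qed.

End Iterates.

Section Cubes.
Variables (X : topologicalType) (T : homeo X) (d : nat).
Hypotheses (cptX : compact [set: X]) (hausX : hausdorff_space X).

Implicit Types (p q u : X -> X) (n m : 'I_d -> int) (v : vertex d).

Definition dot n v : int := \sum_(i < d) n i * (v i : nat)%:Z.

Definition cube_iter n : self_maps X (vertex d) := fun v => iterz T (dot n v).

Definition cube_ellis : set (self_maps X (vertex d)) := closure (range cube_iter).

Definition ellis : set (X -> X) :=
  [set p | closure (range (fun k => (fun=> iterz T k) : self_maps X unit))
             (fun=> p)].

Definition act (e : self_maps X (vertex d)) (z : cube d X) : cube d X :=
  fun v => e v (z v).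

Lemma dotD n m v : dot (fun i => n i + m i) v = dot n v + dot m v.
Proof. by rewrite -big_split; apply: eq_bigr => i _; rewrite mulrDl. Qed.

Lemma dot0 n : dot n (vertex0 d) = 0.
Proof. by rewrite /dot big1 // => i _; rewrite ffunE mulr0. Qed.

Lemma cube_iterD n m :
  cube_iter (fun i => n i + m i) = self_comp (cube_iter n) (cube_iter m).
Proof. by apply: self_mapsP => v x; rewrite /cube_iter dotD iterzD. Qed.

Lemma cube_pointE x n : cube_point T x n = act (cube_iter n) (diag d x).
Proof. by []. Qed.

Lemma act_continuous n : continuous (act (cube_iter n)).
Proof.
apply: ptws_continuous => v z.
apply: (@continuous_comp _ _ _ (fun z : cube d X => z v)).
  exact: ptws_eval_continuous.
exact: iterz_continuous.
Qed.

Lemma act_eval_continuous z : continuous (act^~ z).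
Proof. by apply: ptws_continuous => v; exact: self_eval_continuous. Qed.

Lemma cube_ellis_comp e f :
  cube_ellis e -> cube_ellis f -> cube_ellis (self_comp e f).
Proof.
apply: closure_subsemigroup.
  by move=> _ v [n _ <-]; exact: iterz_continuous.
move=> _ _ [n _ <-] [m _ <-]; exists (fun i => n i + m i) => //.
exact: cube_iterD.
Qed.

Lemma ellis_iterz k : ellis (iterz T k).
Proof. by apply: subset_closure; exists k. Qed.

Lemma cube_ellis_iter n : cube_ellis (cube_iter n).
Proof. by apply: subset_closure; exists n. Qed.

(** The device by which properties pass from iterates of [T] to their limits. *)
Lemma closure_range_sub (A B : topologicalType) (I : Type) (f : A -> B)
    (g : I -> A) (S : set B) :
  continuous f -> (forall i, closure S (f (g i))) ->
  forall a, closure (range g) a -> closure S (f a).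
Proof.
move=> cf fg a ga.
apply: (@closure_subset_closed _ (f @` range g)); first exact: closed_closure.
  by move=> _ [_ [i _ <-] <-].
by apply: image_closure => //; exists a.
Qed.

Lemma cube_ellis_coord e v : cube_ellis e -> ellis (e v).
Proof.
move=> He; apply: (closure_range_sub
  (f := fun e : self_maps X (vertex d) => (fun=> e v) : self_maps X unit) _ _ He).
  by apply: self_maps_continuous => k x; exact: self_eval_continuous.
by move=> n; exact: ellis_iterz.
Qed.

Lemma cube_ellis0 e x : cube_ellis e -> e (vertex0 d) x = x.
Proof.
move=> He.
have : closure [set x] (e (vertex0 d) x).
  apply: (closure_range_sub (f := fun e : self_maps X (vertex d) => _) _ _ He).
    exact: self_eval_continuous.
  by move=> n; apply: subset_closure; rewrite /cube_iter dot0.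
by apply: (accessible_closed_set1 (hausdorff_accessible hausX)).
Qed.

Definition face (j : 'I_d) p : self_maps X (vertex d) :=
  fun v => if v j then p else id.

Lemma dot_delta (j : 'I_d) k v :
  dot (fun i => if i == j then k else 0) v = if v j then k else 0.
Proof.
rewrite /dot (bigD1 j) //= eqxx big1 ?addr0 => [|i /negPf ->].
  by case: (v j); rewrite ?mulr1 ?mulr0.
by rewrite mul0r.
Qed.

Lemma face_iterz j k :
  face j (iterz T k) = cube_iter (fun i => if i == j then k else 0).
Proof.
by apply: self_mapsP => v x; rewrite /face /cube_iter dot_delta; case: (v j).
Qed.

Lemma cube_ellis_face j p : ellis p -> cube_ellis (face j p).
Proof.
move=> Hp; apply: (closure_range_sub
  (f := fun e : self_maps X unit => face j (e tt)) _ _ Hp).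
  apply: self_maps_continuous => v x; rewrite /face; case: (v j).
    exact: self_eval_continuous.
  exact: cst_continuous.
by move=> k; rewrite face_iterz; exact: cube_ellis_iter.
Qed.

(* The projection of the cube onto the face spanned by the first k directions. *)
Definition truncate (k : nat) v : vertex d := [ffun i : 'I_d => (i < k)%N && v i].

(** On [cube_iter n] this erases the exponents from index [k] on. The result acts equally on
    vertices with the same first [k] coordinates, so it moves parallel faces together. *)
Lemma cube_ellis_truncate k e :
  cube_ellis e -> cube_ellis (fun v => e (truncate k v)).
Proof.
move=> He; apply: (closure_range_sub (f := fun e : self_maps X (vertex d) =>
  (fun v => e (truncate k v)) : self_maps X (vertex d)) _ _ He).
  by apply: self_maps_continuous => v x; exact: self_eval_continuous.
move=> n; rewrite (_ : (fun _ => _) =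
  cube_iter (fun i => if (i < k)%N then n i else 0)); first exact: cube_ellis_iter.
apply: self_mapsP => v x; rewrite /cube_iter; congr (iterz T _ x).
by apply: eq_bigr => i _; rewrite ffunE; case: (_ < _)%N; rewrite ?mulr0 ?mul0r.
Qed.

Definition off0 p : self_maps X (vertex d) :=
  fun v => if v == vertex0 d then id else p.

Lemma truncate0 v : truncate 0 v = vertex0 d.
Proof. by apply/ffunP => i; rewrite !ffunE. Qed.

Lemma truncate_id v : truncate d v = v.
Proof. by apply/ffunP => i; rewrite !ffunE ltn_ord. Qed.

(** The product of [face j u] over all directions acts at a vertex with m ones by the m-th power of
    [u], which is [u] once m is positive. *)
Lemma cube_ellis_off0 u : ellis u -> u \o u = u -> cube_ellis (off0 u).
Proof.
move=> Hu uu.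
suff H k : (k <= d)%N -> cube_ellis (fun v => off0 u (truncate k v)).
  have := H d (leqnn d).
  by congr cube_ellis; apply: funext => v; rewrite truncate_id.
elim: k => [_|k IH kd].
  have := @cube_ellis_iter (fun=> 0); congr cube_ellis; apply: self_mapsP => v x.
  rewrite /off0 truncate0 eqxx /cube_iter /dot big1 // => i _; exact: mul0r.
have := @cube_ellis_comp _ _ (@cube_ellis_face (Ordinal kd) _ Hu) (IH (ltnW kd)).
congr cube_ellis; apply: self_mapsP => v x; rewrite /self_comp /face /off0.
have uux y : u (u y) = u y by rewrite -[in RHS]uu.
have -> : (truncate k.+1 v == vertex0 d) =
    (truncate k v == vertex0 d) && ~~ v (Ordinal kd).
  apply/eqP/andP => [/ffunP h|[/eqP /ffunP h nv]].
    split.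
      apply/eqP/ffunP => i; have := h i; rewrite !ffunE ltnS.
      by case: ltnP => // /ltnW ->.
    by have := h (Ordinal kd); rewrite !ffunE ltnSn /= => ->.
  apply/ffunP => i; have [->|ik] := eqVneq i (Ordinal kd).
    by rewrite !ffunE (negPf nv) andbF.
  by have := h i; rewrite !ffunE ltnS ltn_neqAle (_ : (i : nat) != k).
by case: (v (Ordinal kd)); case: (truncate k v == _); rewrite /= ?uux.
Qed.

End Cubes.

Arguments cube_ellis {X} T d.
Arguments cube_iter {X} T {d}.
Arguments act {X d}.

(** * The face group as an image of Z^d *)

Section FaceGroup.
Variables (X : topologicalType) (T : homeo X) (d : nat).
Implicit Types (n m : 'I_d -> int).

Lemma act_iterD n m : act (cube_iter T (fun i => n i + m i)) =
  act (cube_iter T n) \o act (cube_iter T m).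
Proof. by rewrite cube_iterD. Qed.

Lemma act_iter0 : act (cube_iter T (fun _ : 'I_d => 0)) = id.
Proof.
by apply: funext => z; apply: funext => v; rewrite /act /cube_iter /dot big1.
Qed.

Lemma act_iterNK n :
  cancel (act (cube_iter T n)) (act (cube_iter T (fun i => - n i))).
Proof.
have nn0 : (fun i => - n i + n i) = fun=> 0 by apply: funext => i; rewrite addNr.
by move=> z; rewrite -[LHS]/((_ \o _) z) -act_iterD nn0 act_iter0.
Qed.

Lemma act_iterKN n :
  cancel (act (cube_iter T (fun i => - n i))) (act (cube_iter T n)).
Proof.
have nn0 : (fun i => n i - n i) = fun=> 0 by apply: funext => i; rewrite subrr.
by move=> z; rewrite -[LHS]/((_ \o _) z) -act_iterD nn0 act_iter0.
Qed.

Lemma face_mapE (j : 'I_d) :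
  face_map T j = act (cube_iter T (fun i => if i == j then 1 else 0)).
Proof.
rewrite -face_iterz; apply: funext => z; apply: funext => v.
by rewrite /face_map /act /face; case: (v j).
Qed.

(** The right-hand side is a group containing the generators; conversely its elements are built from
    powers of the face maps, one direction after another. *)
Lemma face_groupE : face_group T d = range (fun n => act (cube_iter T n)).
Proof.
apply/seteqP; split.
  apply: smallest_sub; last first.
    move=> _ [j _ <-]; exists (fun i => if i == j then 1 else 0) => //.
    by rewrite face_mapE.
  split; first by exists (fun=> 0) => //; exact: act_iter0.
  - by move=> _ _ [n _ <-] [m _ <-]; exists (fun i => n i + m i); rewrite ?act_iterD.
  - move=> _ g [n _ <-] ng _; exists (fun i => - n i) => //.
    by apply: funext => z; rewrite -[in RHS](act_iterKN n z) ng.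
move=> _ [n _ <-] H [[Hid Hcomp Hinv] Hface].
have Hopp m : H (act (cube_iter T m)) -> H (act (cube_iter T (fun i => - m i))).
  by move=> /Hinv; apply; [exact: act_iterNK|exact: act_iterKN].
have Hdelta j (k : int) : H (act (cube_iter T (fun i => if i == j then k else 0))).
  have Hnat (l : nat) :
      H (act (cube_iter T (fun i => if i == j then l%:Z else 0))).
    elim: l => [|l IH].
      have -> : (fun i => if i == j then 0%:Z else 0) = fun=> 0.
        by apply: funext => i; rewrite if_same.
      by rewrite act_iter0.
    have /Hcomp /(_ IH) : H (face_map T j) by apply: Hface; exists j.
    rewrite face_mapE -act_iterD; congr (H (act (cube_iter T _))).
    by apply: funext => i; case: (i == j); rewrite ?addr0 // -add1n PoszD.
  case: k => l; first exact: Hnat.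
  have := Hopp _ (Hnat l.+1); congr (H (act (cube_iter T _))).
  by apply: funext => i; case: (i == j); rewrite ?oppr0 ?NegzE.
suff Htrunc k : (k <= d)%N ->
    H (act (cube_iter T (fun i : 'I_d => if (i < k)%N then n i else 0))).
  have := Htrunc d (leqnn d); congr (H (act (cube_iter T _))).
  by apply: funext => i; rewrite ltn_ord.
elim: k => [_|k IH kd]; first by rewrite act_iter0.
have := Hcomp _ _ (Hdelta (Ordinal kd) (n (Ordinal kd))) (IH (ltnW kd)).
rewrite -act_iterD; congr (H (act (cube_iter T _))).
apply: funext => i; have [->|ik] := eqVneq i (Ordinal kd).
  by rewrite /= ltnSn ltnn addr0.
by rewrite add0r [in RHS]ltnS [in RHS]leq_eqVlt (negPf (ik : (i : nat) != k)).
Qed.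

End FaceGroup.

(** * Face orbit closures and dynamical cubes *)

Section Orbits.
Variables (X : topologicalType) (T : homeo X) (d : nat).
Hypotheses (cptX : compact [set: X]) (hausX : hausdorff_space X).
Implicit Types (x y : X) (z : cube d X).

(** Evaluation at [z] is continuous on a compact semigroup, so its image is closed and contains all
    limits of the orbit. *)
Lemma face_orbit_closureE z :
  face_orbit_closure T z = (act^~ z) @` cube_ellis T d.
Proof.
have orbE : map_orbit (face_group T d) z = act^~ z @` range (@cube_iter X T d).
  rewrite face_groupE; apply/seteqP; split=> _ [_ [n _ <-] <-].
    by exists (cube_iter T n) => //; exists n.
  by exists (act (cube_iter T n)) => //; exists n.
rewrite /face_orbit_closure orbE; apply/seteqP; split; last first.
  exact/image_closure/act_eval_continuous.
apply: closure_subset_closed; last exact/image_subset/subset_closure.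
apply: image_closed; last exact: closed_closure.
- exact: self_maps_compact.
- exact: ptws_hausdorff.
- exact: act_eval_continuous.
Qed.

Lemma face_orbit_closure_act e z :
  cube_ellis T d e -> face_orbit_closure T z (act e z).
Proof. by rewrite face_orbit_closureE => He; exists e. Qed.

Lemma face_orbit_closure_trans (y z : cube d X) :
  face_orbit_closure T z y -> face_orbit_closure T y `<=` face_orbit_closure T z.
Proof.
rewrite !face_orbit_closureE => -[e He <-] _ [f Hf <-].
by exists (self_comp f e) => //; exact: cube_ellis_comp.
Qed.

Lemma face_orbit_closure_invariant z :
  invariant_set (face_group T d) (face_orbit_closure T z).
Proof.
move=> g; rewrite face_groupE => -[n _ <-] y [w].
rewrite face_orbit_closureE => -[e He <-] <-.
exists (self_comp (cube_iter T n) e) => //.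
by apply: cube_ellis_comp => //; exact: cube_ellis_iter.
Qed.

Lemma face_orbit_closure_sub (A : set (cube d X)) z :
  closed A -> invariant_set (face_group T d) A -> A z ->
  face_orbit_closure T z `<=` A.
Proof.
move=> cA iA Az; apply: closure_subset_closed => // _ [g Gg <-].
by apply: (iA _ Gg); exists z.
Qed.

Lemma dyn_cubes_act e z :
  cube_ellis T d e -> dyn_cubes T d z -> dyn_cubes T d (act e z).
Proof.
move=> He Qz; rewrite /dyn_cubes.
apply: (closure_range_sub (f := act^~ z) _ _ He) => [|n].
  exact: act_eval_continuous.
apply: (@closureS _
  (act (cube_iter T n) @` [set z | exists x n, z = cube_point T x n])).
  move=> _ [_ [x [m ->]] <-]; exists x, (fun i => n i + m i).
  by rewrite !cube_pointE act_iterD.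
by apply: image_closure; [exact: act_continuous|exists z].
Qed.

Lemma dyn_cubes_diag p z :
  ellis T p -> dyn_cubes T d z -> dyn_cubes T d (fun v => p (z v)).
Proof.
move=> Hp Qz; rewrite /dyn_cubes; apply: (closure_range_sub
  (f := fun e : self_maps X unit => (fun v => e tt (z v)) : cube d X) _ _ Hp).
  by apply: ptws_continuous => v; exact: self_eval_continuous.
move=> k; pose h (z : cube d X) : cube d X := fun v => iterz T k (z v).
apply: (@closureS _ (h @` [set z | exists x n, z = cube_point T x n])).
  move=> _ [_ [x [m ->]] <-]; exists (iterz T k x), m.
  by apply: funext => v; rewrite /h /cube_point -!iterzD addrC.
apply: image_closure; last by exists z.
apply: ptws_continuous => v y.
apply: (@continuous_comp _ _ _ (fun z : cube d X => z v)).
  exact: ptws_eval_continuous.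
exact: iterz_continuous.
Qed.

Lemma diag_dyn_cubes x : dyn_cubes T d (diag d x).
Proof.
by apply: subset_closure; exists x, (fun=> 0); rewrite cube_pointE act_iter0.
Qed.

Lemma face_orbit_closure_dyn_cubes_at x :
  face_orbit_closure T (diag d x) `<=` dyn_cubes_at T d x.
Proof.
rewrite face_orbit_closureE => _ [e He <-]; split.
  by apply: dyn_cubes_act => //; exact: diag_dyn_cubes.
exact: (cube_ellis0 hausX x He).
Qed.

End Orbits.

(** * Minimal idempotents and the elements [off0 u] *)

Section MinimalIdempotents.
Variables (X : topologicalType) (T : homeo X) (d : nat).
Hypotheses (cptX : compact [set: X]) (hausX : hausdorff_space X).
Hypothesis minT : minimal_homeo T.

(** By compactness the images of [x] form a closed set; it contains the dense orbit. *)
Lemma ellis_transitive x y : exists2 p, ellis T p & p x = y.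
Proof.
set E := closure (range (fun k => (fun=> iterz T k) : self_maps X unit)).
have cE : closed ((fun e : self_maps X unit => e tt x) @` E).
  apply: image_closed => //; last exact: closed_closure.
  - exact: self_maps_compact.
  - exact: self_eval_continuous.
have : closure [set iterz T n x | n in [set: int]] y.
  move=> V; rewrite nbhsE => -[B [oB By] BV].
  have [|w [Bw xw]] := @minT x B _ oB; first by exists y.
  by exists w; split => //; exact: BV.
move/(closure_subset_closed cE) => [|e Ee <-].
  move=> _ [n _ <-]; exists (fun=> iterz T n) => //.
  by apply: subset_closure; exists n.
exists (e tt) => //; rewrite /ellis /=.
by rewrite (_ : (fun=> e tt) = e) //; apply: funext => -[].
Qed.

(** [mid_min] expresses that [u] generates a minimal left ideal: from [p u] one can return to
    [u]. *)
Record minimal_idempotent (u : X -> X) : Prop := MinimalIdempotent {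
  mid_ellis : ellis T u;
  mid_idem : forall x, u (u x) = u x;
  mid_min : forall p, ellis T p ->
    exists2 q, ellis T q & forall x, q (p (u x)) = u x }.

(** In a minimal left ideal the elements fixing [x] form a closed subsemigroup, nonempty by
    transitivity, and thus contain an idempotent. *)
Lemma minimal_idempotent_fixing x : exists2 u, minimal_idempotent u & u x = x.
Proof.
set E := closure (range (fun k => (fun=> iterz T k) : self_maps X unit)).
have EE (e : self_maps X unit) : E e -> ellis T (e tt).
  move=> Ee; rewrite /ellis /=.
  by rewrite (_ : (fun=> e tt) = e) //; apply: funext => -[].
have cW := @self_maps_compact X unit cptX.
have hW := @self_maps_hausdorff X unit hausX.
have cO := @self_comp_continuous X unit.
have sE : subsemigroup (@self_comp X unit) E.
  apply: closure_subsemigroup.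
    by move=> _ v [n _ <-]; exact: iterz_continuous.
  move=> _ _ [n _ <-] [m _ <-]; exists (n + m) => //.
  by apply: self_mapsP => k y; exact: iterzD.
have E0 : E !=set0 by exists (fun=> iterz T 0); exact: ellis_iterz.
have [L [[a La] cL LE iL Lmin]] := exists_minimal_left_ideal cW hW
  (@self_compA X unit) cO E0 (@closed_closure _ _) sE.
have [|||u [Lu ux] uu] := @exists_idempotent _ _ cW hW
    (@self_compA X unit) cO (L `&` [set e | e tt x = x]).
- have [p Ep px] := ellis_transitive (a tt x) x.
  by exists (self_comp (fun=> p) a); split; [exact: iL|].
- apply: closedI => //.
  apply: (@preimage_closed _ _ (fun e : self_maps X unit => e tt x) [set x]).
    by move=> e _; exact: self_eval_continuous.
  exact/accessible_closed_set1/hausdorff_accessible.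
- move=> e f [Le ex] [Lf fx]; split; first by apply: iL => //; exact: LE.
  by rewrite /= /self_comp fx ex.
exists (u tt) => //; split; first exact/EE/LE.
  by move=> y; rewrite -[in RHS]uu.
move=> p Ep; have [s Es su] := Lmin _ _ (iL (fun=> p) _ Ep Lu) Lu.
by exists (s tt); [exact: EE|move=> y; rewrite -[in RHS]su].
Qed.

Variable u : X -> X.
Hypothesis mu : minimal_idempotent u.

Lemma off0_ellis : cube_ellis T d (off0 u).
Proof.
apply: cube_ellis_off0; first exact: mid_ellis mu.
by apply: funext => x; exact: mid_idem.
Qed.

(** The left ideal generated by [e (off0 u)] contains an idempotent [w], and [off0 u] composed with
    [w] is [off0 u] again. *)
Lemma off0_minimal e : cube_ellis T d e ->
  exists2 f, cube_ellis T d f &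
    self_comp f (self_comp e (off0 u)) = off0 u.
Proof.
move=> He.
have [||_ _ [f Hf <-] [g Hg <-]|_ [f Hf <-] vv] := @exists_idempotent _ _
  (@self_maps_compact X (vertex d) cptX) (@self_maps_hausdorff X (vertex d) hausX)
  (@self_compA X (vertex d)) (@self_comp_continuous X (vertex d))
  (self_comp^~ (self_comp e (off0 u)) @` cube_ellis T d).
- exists (self_comp (off0 u) (self_comp e (off0 u))), (off0 u) => //.
  exact: off0_ellis.
- apply: image_closed; last exact: closed_closure.
  + exact: self_maps_compact.
  + exact: self_maps_hausdorff.
  + exact: self_comp_continuous.
- exists (self_comp f (self_comp (self_comp e (off0 u)) g)) => //.
  do 3!apply: cube_ellis_comp => //; exact: off0_ellis.
exists (self_comp (off0 u) f).
  by apply: cube_ellis_comp => //; exact: off0_ellis.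
set w := self_comp f (self_comp e (off0 u)) in vv.
have Hw : cube_ellis T d w.
  by do 2!apply: cube_ellis_comp => //; exact: off0_ellis.
rewrite self_compA -/w.
apply: self_mapsP => v x; rewrite {1}/self_comp /off0.
have [->|v0] := eqVneq v (vertex0 d).
  exact: (cube_ellis0 hausX _ Hw).
have wu y : w v (u y) = w v y.
  by rewrite /w /self_comp /off0 (negPf v0) mid_idem.
(* Since [w v] absorbs [u] on its right, [q] composed with [w v] is [u]. As [w v] is idempotent, [u]
   composed with [w v] is then [u] too. *)
have [q Hq qwu] := mid_min mu (@cube_ellis_coord _ _ _ _ v Hw).
have ww : w v (w v x) = w v x by rewrite -[in RHS]vv.
by rewrite -(qwu (w v x)) wu ww -wu qwu.
Qed.

End MinimalIdempotents.

(** * Uniqueness of the minimal set *)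

Section GenericPoint.
Variables (R : realType) (X : metricType R) (T : homeo X) (d : nat).
Hypothesis cptX : compact [set: X].

Lemma cube_second_countable (x : X) : second_countable (T := cube d X).
Proof.
pose Y : pseudoPMetricType R :=
  HB.pack (cube d X) (isPointed.Build (cube d X) (diag d x)).
apply: (@compact_second_countable R Y).
exact: ptws_compact.
Qed.

(* Baire argument: [x0] avoids the boundaries of the countably many open sets
   [hit O], for [O] in a countable basis of the cube. *)
Lemma exists_generic_point (x : X) :
  exists x0, dyn_cubes_at T d x0 `<=` face_orbit_closure T (diag d x0).
Proof.
have [B cB [oB Bx]] := cube_second_countable x.
pose hit (G : set (cube d X)) : set X :=
  \bigcup_(n in [set: 'I_d -> int]) (fun y => cube_point T y n) @^-1` G.
have ohit G : open G -> open (hit G).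
  move=> oG; apply: bigcup_open => n _; apply: open_comp => // y _.
  by apply: ptws_continuous => v; exact: iterz_continuous.
have [code codeB] : exists code : nat -> set (cube d X),
    forall G, B G -> exists i, code i = G.
  have /countable_injP [f finj] := cB.
  (* Injectivity leaves at most one set in the union; an index not attained gives the empty set,
     which need not lie in [B], hence the guard [B (code i)] below. *)
  exists (fun i => \bigcup_(G in [set G | B G /\ f G = i]) G) => G BG.
  exists (f G); apply/seteqP; split=> [z [G' [BG' fG'] G'z]|z Gz].
    by rewrite -(finj G' G) ?inE.
  by exists G.
pose state := {V : set X | open V /\ V !=set0}.
(* Each stage decides one basic open set: the new open set lies in its [hit] or misses it. Nesting
   the closures keeps the limit point in every stage. *)
have step (i : nat) (V : state) : {V' : state |
    closure (sval V') `<=` sval V /\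
    (B (code i) -> sval V' `<=` hit (code i) \/ sval V' `&` hit (code i) = set0)}.
  apply: cid; case: V => V [oV [y Vy]] /=.
  have [U [oU Uy cUV hU]] : exists U, [/\ open U, U !=set0, U `<=` V &
      (B (code i) -> U `<=` hit (code i) \/ U `&` hit (code i) = set0)].
    have [[y' [Vy' hy']]|nVh] := pselect (V `&` hit (code i) !=set0).
      have [Bi|nBi] := pselect (B (code i)); last by exists V; split => //; exists y.
      exists (V `&` hit (code i)); split; first 1 last.
      - by exists y'.
      - by move=> ? [].
      - by move=> _; left => ? [].
      by apply: openI => //; apply: ohit; exact: oB.
    exists V; split => //; first by exists y.
    by move=> _; right; apply/eqP/negPn/negP => /set0P.
  have [y' Uy'] := Uy.
  have [A Ay' AU] := @uniform_regular X y' U (open_nbhs_nbhs (conj oU Uy')).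
  have [A' [oA' A'y'] A'A] : exists2 A', open_nbhs y' A' & A' `<=` A.
    by move: Ay'; rewrite nbhsE.
  have sA' : open A' /\ A' !=set0 by split => //; exists y'.
  have A'U : A' `<=` U by move=> t /A'A /subset_closure /AU.
  exists (exist _ A' sA'); split => /=.
    by move=> t /(closureS A'A)/AU/cUV.
  move=> /hU [UH|UH]; [left|right]; first by move=> t /A'U/UH.
  by apply/seteqP; split => // t [/A'U Ut ht]; rewrite -UH.
have S0 : open [set: X] /\ [set: X] !=set0 by split; [exact: openT|exists x].
pose fix V (i : nat) : state :=
  if i is i'.+1 then sval (step i' (V i')) else exist _ setT S0.
have Vsub i j : (i <= j)%N -> sval (V j) `<=` sval (V i).
  elim: j => [|j IH]; first by rewrite leqn0 => /eqP ->.
  rewrite leq_eqVlt => /predU1P[-> //|/IH sub] t Vt; apply: sub.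
  by apply: (svalP (step j (V j))).1; exact: subset_closure.
have [|i j _ _|i _|x0 Vx0] := directed_bigcap (D := [set: nat])
    (f := fun i => closure (sval (V i))) cptX.
- by exists 0%N.
- exists (maxn i j) => //; rewrite subsetI; split; apply: closureS; apply: Vsub;
    [exact: leq_maxl|exact: leq_maxr].
- split; first exact: closed_closure.
  by have [y Vy] := (svalP (V i)).2; exists y; exact: subset_closure.
have {}Vx0 i : sval (V i) x0.
  by apply: (svalP (step i (V i))).1; exact: (Vx0 i.+1).
exists x0 => y [Qy y0] N Ny.
have [G [BG Gy] GN] := Bx y N Ny.
have [i ei] := codeB G BG.
have oVi := (svalP (V i.+1)).1.
(* Near [y] there is a cube point in [G] over a point of stage [i.+1]. This stage thus meets
   [hit (code i)], so it lies inside, and [x0] too has a cube point in [G]. *)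
have : nbhs y (G `&` (fun z : cube d X => z (vertex0 d)) @^-1` sval (V i.+1)).
  apply: filterI; first by apply: open_nbhs_nbhs; split => //; exact: oB.
  apply: (@ptws_eval_continuous (vertex d) X (vertex0 d)).
  by apply: open_nbhs_nbhs; split => //; rewrite y0.
move=> /Qy [_ [[x' [n ->]] [Gx' Vx']]].
have x'i : cube_point T x' n (vertex0 d) = x'.
  by rewrite /cube_point -/(dot n _) dot0.
rewrite /= x'i in Vx'.
have hx' : hit (code i) x' by exists n => //; rewrite ei.
have Bi : B (code i) by rewrite ei.
have [sub|dis] := (svalP (step i (V i))).2 Bi.
  have [m _ Gm] := sub _ (Vx0 i.+1).
  exists (cube_point T x0 m); split; last by apply: GN; rewrite -ei.
  by exists (act (cube_iter T m)) => //; rewrite face_groupE; exists m.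
by have : set0 x' by rewrite -dis.
Qed.
End GenericPoint.

(** * From an arbitrary cube over a point to the diagonal point *)

Section Uniqueness.
Variables (X : topologicalType) (T : homeo X) (d : nat).
Hypotheses (cptX : compact [set: X]) (hausX : hausdorff_space X).
Hypothesis minT : minimal_homeo T.
Implicit Types (x y : X) (z : cube d X).

(** If [u x = x], then [off0 u] fixes the diagonal point, and the [f] returning from [e (off0 u)] to
    [off0 u] undoes [e] there. *)
Lemma diag_orbit_minimal x z :
  face_orbit_closure T (diag d x) z -> face_orbit_closure T z (diag d x).
Proof.
rewrite face_orbit_closureE // => -[e He <-].
have [u mu ux] := minimal_idempotent_fixing cptX hausX minT x.
have [f Hf fe] := off0_minimal cptX hausX mu He.
have uv v : off0 u v x = x by rewrite /off0; case: ifP.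
have back : act f (act e (diag d x)) = diag d x.
  apply: funext => v; have := congr1 (fun h => h v x) fe.
  by rewrite /self_comp /act /diag uv.
by rewrite -[X in _ X]back; exact: face_orbit_closure_act.
Qed.

(** The vertices fixed by [truncate k] are those of the lower face spanned by the first [k]
    directions. *)
Definition lower_face_diag k x z :=
  forall v : vertex d, truncate k v = v -> z v = x.

Lemma truncateS k (kd : (k < d)%N) (v : vertex d) : truncate k.+1 v = v ->
  v (Ordinal kd) = false -> truncate k v = v.
Proof.
move=> /ffunP h vk; apply/ffunP => i; have := h i; rewrite !ffunE ltnS.
have [->|ik] := eqVneq i (Ordinal kd); first by rewrite vk !andbF.
by rewrite leq_eqVlt (negPf (ik : (i : nat) != k)).
Qed.

Lemma truncate_lt k (kd : (k < d)%N) (v : vertex d) :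
  truncate k v (Ordinal kd) = false.
Proof. by rewrite ffunE ltnn. Qed.

Lemma truncate_idem k (v : vertex d) : truncate k (truncate k v) = truncate k v.
Proof. by apply/ffunP => i; rewrite !ffunE andbA andbb. Qed.

Lemma lower_face_step x0 k (kd : (k < d)%N) x z :
  dyn_cubes_at T d x0 `<=` face_orbit_closure T (diag d x0) ->
  dyn_cubes T d z -> lower_face_diag k x z ->
  exists2 e, cube_ellis T d e & lower_face_diag k.+1 x (act e z).
Proof.
move=> gen0 Qz zx; pose j := Ordinal kd.
have comp := @cube_ellis_comp X T d.
have Hface := @cube_ellis_face X T d j.
have [u mu ux] := minimal_idempotent_fixing cptX hausX minT x.
have Hu := mid_ellis mu; have uu := mid_idem mu.
have Hw := @off0_ellis _ T d u mu.
(* This keeps the lower face at [x] and makes every coordinate a fixed point of [u]. *)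
pose z' : cube d X := act (off0 u) z.
have zx' : lower_face_diag k x z'.
  by move=> v /zx zv; rewrite /z' /act zv /off0; case: ifP.
have z'0 : z' (vertex0 d) = x.
  by apply: zx'; apply/ffunP => i; rewrite !ffunE andbF.
have uz' v : u (z' v) = z' v.
  have [->|v0] := eqVneq v (vertex0 d); first by rewrite z'0.
  by rewrite /z' /act /off0 (negPf v0) uu.
have [p Hp px] := ellis_transitive cptX hausX minT x x0.
have [q Hq qp] := mid_min mu Hp.
have [a Ha az] : exists2 a, cube_ellis T d a & act a (diag d x0) = fun v => p (z' v).
  have : dyn_cubes_at T d x0 (fun v => p (z' v)).
    split; last by rewrite z'0.
    by apply: dyn_cubes_diag => //; apply: dyn_cubes_act.
  by move/gen0; rewrite face_orbit_closureE // => -[a Ha <-]; exists a.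
have [r Hr rx] := ellis_transitive cptX hausX minT x0 x.
pose x1 := u x0.
(* On the diagonal point over [x0], [b] yields [x1] on the lower face off the zero vertex, and [z']
   wherever [v j] holds, since [q] undoes [p] on fixed points of [u]. *)
pose b := self_comp (off0 u) (self_comp (face j q) a).
have Hb : cube_ellis T d b by exact: comp _ _ Hw (comp _ _ (Hface q Hq) Ha).
have [w mw wx] := minimal_idempotent_fixing cptX hausX minT x0.
have [f Hf fb] := off0_minimal cptX hausX mw Hb.
have fb0 v : f v (b v x0) = x0.
  have wv : off0 w v x0 = x0 by rewrite /off0; case: ifP.
  by have := congr1 (fun h => h v x0) fb; rewrite /self_comp wv.
(* [f] undoes [b] on that diagonal point, and [r] then moves [x0] to [x] where [v j] holds. So [phi]
   fixes [x1] on the lower face and sends the upper part of [z'] to [x]. *)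
pose phi := self_comp (off0 u) (self_comp (face j r) f).
have Hphi : cube_ellis T d phi by exact: comp _ _ Hw (comp _ _ (Hface r Hr) Hf).
have phiE v : phi v (b v x0) = off0 u v (face j r v x0).
  by rewrite /phi /self_comp fb0.
have bE v : b v x0 = off0 u v (face j q v (p (z' v))).
  by rewrite /b /self_comp -[a v x0]/(act a (diag d x0) v) az.
have phi_low v : truncate k v = v -> v != vertex0 d -> phi v x1 = x1.
  move=> kv v0; have := phiE v; rewrite bE /off0 (negPf v0) /face.
  by rewrite -kv truncate_lt kv zx' // px.
have phi_up (v : vertex d) : v j -> phi v (z' v) = x.
  move=> vj; have v0 : v != vertex0 d.
    by apply/eqP => v0; move: vj; rewrite v0 ffunE.
  have := phiE v; rewrite bE /off0 (negPf v0) /face vj rx ux.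
  by rewrite -[in p _](uz' v) qp !uz'.
(* [psi] undoes [phi] on the fixed points of [u], hence at [x]; on the lower face it fixes [x1]
   because [phi] does. *)
have [psi Hpsi psiphi] := off0_minimal cptX hausX mu Hphi.
have psi_phi v y : v != vertex0 d -> psi v (phi v (u y)) = u y.
  move=> v0; have := congr1 (fun h => h v y) psiphi.
  by rewrite /self_comp /off0 (negPf v0).
have psi_phi_x v : psi v (phi v x) = x.
  have [->|v0] := eqVneq v (vertex0 d); last by rewrite -[in LHS]ux psi_phi.
  by rewrite (cube_ellis0 hausX _ Hphi) (cube_ellis0 hausX _ Hpsi).
have psi_x1 v : truncate k v = v -> psi v x1 = x1.
  move=> kv; have [->|v0] := eqVneq v (vertex0 d).
    exact: (cube_ellis0 hausX _ Hpsi).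
  by rewrite -[in LHS](phi_low v) // psi_phi.
have [s Hs sx] := ellis_transitive cptX hausX minT x x1.
have [t Ht tx] := ellis_transitive cptX hausX minT x1 x.
(* After [phi], [s] moves the upper face from [x] to [x1]; the truncated [psi] restores [x] below
   and keeps [x1] above; [t] brings [x1] to [x]. *)
exists (self_comp (face j t) (self_comp (fun v => psi (truncate k v))
  (self_comp (face j s) (self_comp phi (off0 u))))).
  exact: comp _ _ (Hface t Ht) (comp _ _ (@cube_ellis_truncate X T d k psi Hpsi)
    (comp _ _ (Hface s Hs) (comp _ _ Hphi Hw))).
move=> v kv; rewrite /act /self_comp -[off0 u v (z v)]/(z' v) /face.
case vj : (v j).
  by rewrite phi_up // sx psi_x1 ?tx // truncate_idem.
have {}kv := truncateS kv vj.
by rewrite kv zx' // psi_phi_x.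
Qed.

(** The constant face grows from the zero vertex to the whole cube; one [x0] serves every [x]. *)
Lemma diag_in_face_orbit_closure x0 x z :
  dyn_cubes_at T d x0 `<=` face_orbit_closure T (diag d x0) ->
  dyn_cubes_at T d x z -> face_orbit_closure T z (diag d x).
Proof.
move=> gen0 [Qz zx].
suff H k : (k <= d)%N ->
    exists2 e, cube_ellis T d e & lower_face_diag k x (act e z).
  have [e He ex] := H d (leqnn d).
  have <- : act e z = diag d x by apply: funext => v; apply/ex/truncate_id.
  exact: face_orbit_closure_act.
elim: k => [_|k IH kd].
  exists (cube_iter T (fun=> 0)); first exact: cube_ellis_iter.
  by rewrite act_iter0 => v <-; rewrite truncate0.
have [e He ex] := IH (ltnW kd).
have [f Hf fx] := lower_face_step kd gen0 (dyn_cubes_act He Qz) ex.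
by exists (self_comp f e) => //; exact: cube_ellis_comp.
Qed.

End Uniqueness.

(** * Minimality of the diagonal orbit closures and their uniqueness over each point *)

Theorem theorem3p1 (R : realType) (X : metricType R) (T : homeo X) (d : nat)
    (cptX : compact [set: X]) (minT : minimal_homeo T) (d_ge1 : (1 <= d)%N) :
  (forall x : X,
     minimal_system (face_group T d) (face_orbit_closure T (diag d x))) /\
  (forall x : X,
     [/\ face_orbit_closure T (diag d x) `<=` dyn_cubes_at T d x,
         minimal_set (face_group T d) (face_orbit_closure T (diag d x)) &
         forall M : set (cube d X),
           M `<=` dyn_cubes_at T d x -> minimal_set (face_group T d) M ->
           M = face_orbit_closure T (diag d x)]).
Proof.
have hausX := @metric_hausdorff R X.
have minN x : minimal_set (face_group T d) (face_orbit_closure T (diag d x)).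
  split.
  - by exists (diag d x); rewrite face_orbit_closureE //;
       exists (cube_iter T (fun=> 0)); [exact: cube_ellis_iter|rewrite act_iter0].
  - exact: closed_closure.
  - exact: face_orbit_closure_invariant.
  - move=> B [y By] cB iB BN; apply/seteqP; split=> //.
    apply: subset_trans (face_orbit_closure_sub cB iB By).
    apply: face_orbit_closure_trans => //.
    by apply: diag_orbit_minimal => //; exact: BN.
split=> x.
  split.
  - apply: (@subclosed_compact _ _ [set: cube d X]) => //.
      exact: closed_closure.
    exact: ptws_compact.
  - exact: face_orbit_closure_invariant.
  - move=> y Ny; apply: face_orbit_closure_trans => //.
    exact: diag_orbit_minimal.
split=> // [|M MQ [[z Mz] cM iM Mmin]].
  exact: face_orbit_closure_dyn_cubes_at.
have [x0 gen0] := exists_generic_point T d cptX x.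
have [N0 cN iN _] := minN x.
(* [M] contains the orbit closure of [z], hence that of the diagonal point, and minimality of [M]
   gives equality. *)
apply/esym/Mmin => //; apply: subset_trans (face_orbit_closure_sub cM iM Mz).
apply: face_orbit_closure_trans => //.
by apply: (diag_in_face_orbit_closure cptX hausX minT gen0); exact: MQ.
Qed.
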